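(* Let $L:[0,T]\times\mathbb{R}^N\times\mathbb{R}^N\to\mathbb{R}\cup\{\pm\infty\}$ satisfy (L1)–(L5), let $g:\mathbb{R}^N\to\mathbb{R}\cup\{\pm\infty\}$ be proper and lower semicontinuous, and let $V$ be the value function associated with $L$ and $g$. Then for every $(t_0,x_0)\in\mathrm{dom}\,V\cap(0,T]\times\mathbb{R}^N$ and every $v_0\in\mathrm{dom}\,L(t_0,x_0,\cdot)$, one has $dV(t_0,x_0)(-1,-v_0)\leq L(t_0,x_0,v_0)$.
   Context: $\mathbb{B}_R$ is the closed ball of radius $R$ at $0$; $\mathrm{dom}\,\varphi=\{z:\varphi(z)\neq\pm\infty\}$; $\varphi$ is proper if it never equals $-\infty$ and is not identically $+\infty$. Value function: for $t_0\in[0,T)$, $V(t_0,x_0)=\inf\{g(x(T))+\int_{t_0}^TL(t,x(t),\dot x(t))\,dt\}$ over absolutely continuous $x:[t_0,T]\to\mathbb{R}^N$ with $x(t_0)=x_0$; $V(T,x_0)=g(x_0)$. $V$ is regarded as $+\infty$ outside $[0,T]\times\mathbb{R}^N$. Subderivative at $z$ with $\varphi(z)$ finite: $d\varphi(z)(v)=\liminf_{\tau\to0^+,\,y\to v}(\varphi(z+\tau y)-\varphi(z))/\tau$. (L1) $L$ is lower semicontinuous in all variables. (L2) $L(t,x,\cdot)$ is convex and proper for every $t,x$. (L3) for every $(t,x,v)$ and every $(t_n,x_n)\to(t,x)$ there exist $v_n\to v$ with $L(t_n,x_n,v_n)\to L(t,x,v)$. (L4) for every $R\geq0$ there is $C_R\geq0$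 with $L(t,x,v)=+\infty$ whenever $t\in[0,T]$, $x\in\mathbb{B}_R$, $|v|>C_R$. (L5) there are an integrable $c:[0,T]\to[0,\infty)$ and a null set $\mathcal{N}$ with $L(t,x,v)=+\infty$ whenever $t\notin\mathcal{N}$ and $|v|>c(t)(1+|x|)$. *)

(* Defs.v *)
From HB Require Import structures.
From mathcomp Require Import all_boot all_order all_algebra.
From mathcomp Require Import all_classical all_reals all_analysis.
Set Implicit Arguments. Unset Strict Implicit. Unset Printing Implicit Defensive.
Import Order.TTheory GRing.Theory Num.Theory.
Import numFieldNormedType.Exports.
Local Open Scope classical_set_scope.
Local Open Scope ring_scope.

Section defs.
Context {R : realType} {N : nat}.

Definition enorm (v : 'rV[R]_N) : R := Num.sqrt (\sum_(i < N) v ord0 i ^+ 2).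

Definition abs_cont_on (a b : R) (x : R -> 'rV[R]_N) : Prop :=
  forall eps : R, 0 < eps -> exists2 delta : R, 0 < delta &
    forall (n : nat) (I : 'I_n -> R * R),
      (forall i, a <= (I i).1 /\ (I i).1 <= (I i).2 /\ (I i).2 <= b) ->
      (forall i j, i != j -> (I i).2 <= (I j).1 \/ (I j).2 <= (I i).1) ->
      \sum_(i < n) ((I i).2 - (I i).1) < delta ->
      \sum_(i < n) enorm (x (I i).2 - x (I i).1) < eps.

Local Open Scope ereal_scope.

Definition lsc_L (T : R) (L : R -> 'rV[R]_N -> 'rV[R]_N -> \bar R) : Prop :=
  forall (p : (R * 'rV[R]_N) * 'rV[R]_N) (a : R),
    (0 <= p.1.1 <= T)%R -> a%:E < L p.1.1 p.1.2 p.2 ->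
    exists2 U, nbhs p U & forall q, U q -> (0 <= q.1.1 <= T)%R ->
      a%:E < L q.1.1 q.1.2 q.2.

(* convexity of an extended-real-valued function (values in (-oo,+oo]) *)
Definition econvex (f : 'rV[R]_N -> \bar R) : Prop :=
  forall (u v : 'rV[R]_N) (l : R), (0 < l < 1)%R ->
    f (l *: u + (1 - l) *: v)%R <= l%:E * f u + (1 - l)%:E * f v.

Definition eproper {T : Type} (f : T -> \bar R) : Prop :=
  (forall z, f z != -oo) /\ (exists z, f z != +oo).

Definition value_fun (T : R) (L : R -> 'rV[R]_N -> 'rV[R]_N -> \bar R)
  (g : 'rV[R]_N -> \bar R) (t0 : R) (x0 : 'rV[R]_N) : \bar R :=
  if (0 <= t0)%R && (t0 < T)%R then
    ereal_inf [set g (x T) +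
                 \int[@lebesgue_measure R]_(t in [set t | t0 <= t <= T]%R)
                    L t (x t) ('D_1 x t)
              | x in [set x : R -> 'rV[R]_N | abs_cont_on t0 T x /\ x t0 = x0]]
  else if t0 == T then g x0 else +oo.

(* subderivative d phi (t,x) (a,w) of phi : R x R^N -> \bar R, i.e.
   liminf_{tau -> 0+, (b,y) -> (a,w)} (phi((t,x) + tau (b,y)) - phi(t,x)) / tau *)
Definition subderiv (phi : R -> 'rV[R]_N -> \bar R) (t : R) (x : 'rV[R]_N)
  (a : R) (w : 'rV[R]_N) : \bar R :=
  ereal_sup [set ereal_inf
     [set e | exists tau b y, [/\ (0 < tau < eps)%R, (`|b - a| < eps)%R,
               (enorm (y - w) < eps)%R &
               e = (phi (t + tau * b)%R (x + tau *: y)%R - phi t x) * (tau^-1)%:E]]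
   | eps in [set eps : R | (0 < eps)%R]].

End defs.

(* Main.v *)
(** For [c] slightly above [L t0 x0 v0], the velocities [v] with [L t x v <= c]
    form a closed convex set varying continuously near [(t0, x0)]: (L1) gives the
    closed graph, and (L3) with convexity the lower semicontinuity.  Hence the
    point [f t x] of this set nearest to [v0] is a continuous selection, and
    Peano's theorem yields a C^1 arc [z] with [z' = f t z], [z t0 = x0] running
    backwards from [t0].  Along it the running cost is at most [c] and
    [z (t0 - tau) = x0 - tau v0 + o(1) tau].  Concatenating [z] with a
    near-optimal arc from [(t0, x0)] gives
    [V (t0 - tau) (z (t0 - tau)) <= V t0 x0 + c tau], which bounds the
    subderivative.

    The integral of an arbitrary function is the difference of the suprema of the
    simple functions below its positive and negative parts; it is monotone and
    splits over disjoint measurable sets even for non-measurable integrands, so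
    nothing has to be known about the derivative of the near-optimal arc. *)

Require Import Defs.
From HB Require Import structures.
From mathcomp Require Import all_boot all_order all_algebra.
From mathcomp Require Import all_classical all_reals all_analysis.
From mathcomp Require Import ring lra.
Import Order.TTheory GRing.Theory Num.Theory.
Import numFieldNormedType.Exports.
Local Open Scope classical_set_scope.
Local Open Scope ring_scope.

Set Implicit Arguments.
Unset Strict Implicit.
Unset Printing Implicit Defensive.

(** * Monotonicity and additivity of the integral for arbitrary integrands *)

Section integral_without_measurability.
Local Open Scope ereal_scope.
Context {d : measure_display} {T : measurableType d} {R : realType}.
Variable mu : {measure set T -> \bar R}.
Implicit Types (f g : T -> \bar R) (A B D : set T).
Import HBNNSimple.

(** The two suprema are absorbed one after the other, the other summand being held fixed. *)
Lemma ge0_ereal_sup_addl (S S' : set (\bar R)) (M : \bar R) :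
  S !=set0 -> S' !=set0 ->
  (forall a, S a -> 0 <= a) -> (forall b, S' b -> 0 <= b) ->
  (forall a b, S a -> S' b -> a + b <= M) -> ereal_sup S + ereal_sup S' <= M.
Proof.
move=> [a0 Sa0] [b0 Sb0] S0 S'0 SM.
have sup_add (U : set (\bar R)) c : 0 <= c -> U !=set0 ->
    (forall a, U a -> 0 <= a /\ a + c <= M) -> ereal_sup U + c <= M.
  move=> c0 [u Uu] UM.
  have [cfin|] := boolP (c \is a fin_num).
    rewrite -leeBrDr//; apply: ge_ereal_sup => a Ua.
    by rewrite leeBrDr//; apply: (UM a Ua).2.
  (* An infinite [c] cannot be subtracted, but then a single [u >= 0] forces [M = +oo]. *)
  rewrite ge0_fin_numE// -leNgt leye_eq => /eqP cy.
  by have [u0] := UM _ Uu; rewrite cy addey ?leye_eq; [move=> /eqP ->; rewrite leey|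
    rewrite gt_eqF// (lt_le_trans _ u0)// ltNy0].
rewrite addeC; apply: (sup_add).
- by apply: (le_trans (S0 _ Sa0)); exact: ereal_sup_ubound.
- by exists b0.
move=> b Sb; split; first exact: S'0.
rewrite addeC; apply: (sup_add); first exact: S'0.
- by exists a0.
- by move=> a Sa; split; [exact: S0|exact: SM].
Qed.

Lemma ge0_le_integralW D f g : (forall x, D x -> 0 <= f x) ->
  (forall x, D x -> f x <= g x) -> \int[mu]_(x in D) f x <= \int[mu]_(x in D) g x.
Proof.
move=> f0 fg; have g0 x : D x -> 0 <= g x by move=> Dx; apply: (le_trans (f0 _ Dx)); exact: fg.
rewrite !ge0_integralE//; apply: le_ereal_sup => _ [h hf <-]; exists h => //= x.
apply: (le_trans (hf x)); rewrite /patch; case: ifPn => //.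
by rewrite inE; exact: fg.
Qed.

Lemma le_integralW D f g :
  (forall x, D x -> f x <= g x) -> \int[mu]_(x in D) f x <= \int[mu]_(x in D) g x.
Proof.
move=> fg; rewrite [leLHS]integralE [leRHS]integralE; apply: leeB.
  apply: ge0_le_integralW => x Dx; first exact: funepos_ge0.
  by rewrite !funeposE ge_max le_max fg//= le_max lexx orbT.
apply: ge0_le_integralW => x Dx; first exact: funeneg_ge0.
by rewrite !funenegE ge_max le_max leeN2 fg//= le_max lexx orbT.
Qed.

(** A simple function below [f] on the union is the sum of its cut-offs to [A] and [B]; conversely,
    simple functions below the two restrictions add up to one below [f] on the union. *)
Lemma ge0_integral_setUW A B f : measurable A -> measurable B ->
  [disjoint A & B] -> (forall x, (A `|` B) x -> 0 <= f x) ->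
  \int[mu]_(x in A `|` B) f x = \int[mu]_(x in A) f x + \int[mu]_(x in B) f x.
Proof.
move=> mA mB dAB f0.
have fA x : A x -> 0 <= f x by move=> ?; apply: f0; left.
have fB x : B x -> 0 <= f x by move=> ?; apply: f0; right.
have AB x : A x -> B x -> False.
  by move=> Ax Bx; move/disj_setPS: dAB => /(_ x); apply; split.
rewrite !ge0_integralE//; apply/eqP; rewrite eq_le; apply/andP; split.
- apply: ge_ereal_sup => _ [h hf <-].
  have projE D (mD : measurable D) x :
    proj_nnsfun h mD x = (h x * (x \in D)%:R)%R by [].
  have -> : sintegral mu h =
      sintegral mu (proj_nnsfun h mA) + sintegral mu (proj_nnsfun h mB).
    rewrite -sintegralD; apply: eq_sintegral => x; rewrite [RHS]/GRing.add_fun.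
    rewrite !projE; have := hf x; rewrite /patch.
    have [/set_mem Ax|nAx] := boolP (x \in A).
      have -> : (x \in B) = false by apply: memNset; exact: AB Ax.
      by rewrite mulr1 mulr0 addr0.
    have [/set_mem Bx|nBx] := boolP (x \in B); first by rewrite mulr0 mulr1 add0r.
    rewrite memNset; last by case=> /mem_set; [rewrite (negPf nAx)|rewrite (negPf nBx)].
    rewrite lee_fin => hx; rewrite !mulr0 addr0.
    by apply/eqP; rewrite eq_le hx/=; exact: fun_ge0.
  apply: leeD; apply: ereal_sup_ubound; eexists; try reflexivity; move=> x.
  + rewrite projE /patch; case: ifPn => [/set_mem Ax|_]; last by rewrite mulr0.
    by rewrite mulr1; have := hf x; rewrite /patch mem_set//; left.
  + rewrite projE /patch; case: ifPn => [/set_mem Ax|_]; last by rewrite mulr0.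
    by rewrite mulr1; have := hf x; rewrite /patch mem_set//; right.
- have ne D : (forall x, D x -> 0 <= f x) ->
      [set sintegral mu h | h in [set h : {nnsfun T >-> R} |
        forall x, (h x)%:E <= (f \_ D) x]] !=set0.
    move=> D0; exists 0, nnsfun0; last by rewrite sintegral0.
    by move=> x; rewrite /patch /=; case: ifPn => // /set_mem /D0.
  apply: ge0_ereal_sup_addl; [exact: ne|exact: ne| | |].
  + by move=> _ [h _ <-]; exact: sintegral_ge0.
  + by move=> _ [h _ <-]; exact: sintegral_ge0.
  move=> _ _ [h hf <-] [k kf <-]; rewrite -sintegralD.
  apply: ereal_sup_ubound; exists (add_nnsfun h k) => // x /=.
  move: (hf x) (kf x); rewrite /patch.
  have [/set_mem Ax|nAx] := boolP (x \in A).
    have -> : (x \in B) = false by apply: memNset; exact: AB Ax.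
    rewrite mem_set; last by left.
    by move=> hx kx; rewrite EFinD -[leRHS]adde0; exact: leeD.
  have [/set_mem Bx|nBx] := boolP (x \in B).
    rewrite mem_set; last by right.
    by move=> hx kx; rewrite EFinD -[leRHS]add0e; exact: leeD.
  rewrite memNset; last by case=> /mem_set; [rewrite (negPf nAx)|rewrite (negPf nBx)].
  by move=> hx kx; rewrite EFinD -[leRHS]add0e; exact: leeD.
Qed.

Lemma integral_setU_le_cst A B f (c : R) : measurable A -> measurable B ->
  [disjoint A & B] -> mu A \is a fin_num -> (forall x, A x -> f x <= c%:E) ->
  \int[mu]_(x in B) f x \is a fin_num ->
  \int[mu]_(x in A `|` B) f x <= c%:E * mu A + \int[mu]_(x in B) f x.
Proof.
move=> mA mB dAB muA fc.
have AB x : A x -> B x -> False.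
  by move=> Ax Bx; move/disj_setPS: dAB => /(_ x); apply; split.
(* Raising [f] to the constant [c] on [A] makes the integrals of both parts over [A] explicit. *)
pose g x := if x \in A then c%:E else f x.
have gA x : A x -> g x = c%:E by move=> Ax; rewrite /g mem_set.
have gB x : B x -> g x = f x.
  by move=> Bx; rewrite /g memNset// => Ax; exact: AB Ax Bx.
have fg : \int[mu]_(x in A `|` B) f x <= \int[mu]_(x in A `|` B) g x.
  by apply: le_integralW => x [Ax|Bx]; [rewrite gA// fc|rewrite gB].
have -> : \int[mu]_(x in B) f x = \int[mu]_(x in B) g x.
  by apply: eq_integral => x /set_mem/gB ->.
move=> gfin; apply: (le_trans fg) => {fg}.
have pA : \int[mu]_(x in A) g^\+ x = (Num.max c 0)%:E * mu A.
  rewrite -integral_cst//; apply: eq_integral => x /set_mem Ax.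
  by rewrite !funeposE gA// -EFin_max.
have nA : \int[mu]_(x in A) g^\- x = (Num.max (- c) 0)%:E * mu A.
  rewrite -integral_cst//; apply: eq_integral => x /set_mem Ax.
  by rewrite !funenegE gA// -EFinN -EFin_max.
rewrite integralE [in leRHS]integralE.
rewrite (ge0_integral_setUW mA mB dAB (fun x _ => funepos_ge0 g x)) pA.
rewrite (ge0_integral_setUW mA mB dAB (fun x _ => funeneg_ge0 g x)) nA.
move: gfin; rewrite integralE.
have : 0 <= \int[mu]_(x in B) g^\+ x by apply: integral_ge0 => *; exact: funepos_ge0.
have : 0 <= \int[mu]_(x in B) g^\- x by apply: integral_ge0 => *; exact: funeneg_ge0.
rewrite -(fineK muA).
(* Since their difference is finite, both parts have a real integral over [B]. *)
case: (\int[mu]_(x in B) g^\+ x) => [a| |];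
  case: (\int[mu]_(x in B) g^\- x) => [b| |] //= _ _ _.
rewrite -!EFinM lee_fin.
suff -> : Num.max c 0%R = (c + Num.max (- c) 0)%R by rewrite mulrDl; lra.
by rewrite addr_maxr subrr addr0 maxC.
Qed.
End integral_without_measurability.

(** * Limits of bounded sequences along ultrafilters *)

Section ultrafilter_limits.
Context {R : realType} {N : nat}.

(** Closed balls are compact, and a cluster point of an ultrafilter is its limit. This stands in for
    the extraction of subsequences. *)
Lemma ultra_bounded_cvg (U : set_system nat) (u : nat -> 'rV[R]_N) (M : R) :
  UltraFilter U -> (\forall n \near U, `|u n| <= M) ->
  exists l : 'rV[R]_N, u n @[n --> U] --> l.
Proof.
move=> UU uM; have PU : ProperFilter U by exact: ultra_proper.
have cK : compact [set v : 'rV[R]_N | `|v| <= M].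
  apply: bounded_closed_compact.
    by exists M; split; [exact: num_real|move=> x /ltW Mx v /= /le_trans; apply].
  apply: (@preimage_closed _ _ (fun v : 'rV[R]_N => `|v|) [set x | x <= M]).
    by move=> x _; exact: norm_continuous.
  exact: closed_le.
have [l [_ clu]] := cK (u @ U) _ uM.
exists l => B Bl; have [//|nB] := in_ultra_setVsetC (u @^-1` B) UU.
by have [x [/= nBx /nBx]] := clu (~` B) B nB Bl.
Qed.

End ultrafilter_limits.

(** * Peano's existence theorem by Euler's scheme *)

Section peano.
Context {R : realType} {N : nat}.
Variables (G : R -> 'rV[R]_N -> 'rV[R]_N) (x0 : 'rV[R]_N).

Fixpoint euler (h : R) (k : nat) : 'rV[R]_N :=
  if k is j.+1 then euler h j + h *: G (j%:R * h) (euler h j) else x0.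

(** Each step deviates from the constant velocity [w] by at most [h r], and the deviations add
    up. *)
Lemma euler_dist (h : R) (w : 'rV[R]_N) (r : R) (m k : nat) : 0 <= h -> (m <= k)%N ->
  (forall j, (m <= j < k)%N -> `|G (j%:R * h) (euler h j) - w| <= r) ->
  `|euler h k - euler h m - ((k%:R - m%:R) * h) *: w| <= r * ((k%:R - m%:R) * h).
Proof.
move=> h0; elim: k => [|k IH].
  by rewrite leqn0 => /eqP -> _; rewrite !subrr mul0r scale0r subrr normr0 mulr0.
rewrite leq_eqVlt => /predU1P[-> _|].
  by rewrite !subrr mul0r scale0r subrr normr0 mulr0.
rewrite ltnS => mk Gw.
have -> : euler h k.+1 - euler h m - ((k.+1%:R - m%:R) * h) *: w =
    (euler h k - euler h m - ((k%:R - m%:R) * h) *: w) +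
    h *: (G (k%:R * h) (euler h k) - w).
  by apply/rowP => i; rewrite /= !mxE -natr1; ring.
apply: (le_trans (ler_normD _ _)).
have -> : r * ((k.+1%:R - m%:R) * h) = r * ((k%:R - m%:R) * h) + h * r.
  by rewrite -natr1; ring.
apply: lerD.
  by apply: IH => // j /andP[mj jk]; apply: Gw; rewrite mj ltnS ltnW.
rewrite normrZ (ger0_norm h0); apply: ler_wpM2l => //.
by apply: Gw; rewrite mk ltnSn.
Qed.

Lemma euler_lipschitz (h M : R) (m k : nat) : 0 <= h ->
  (forall t z, `|G t z| <= M) ->
  `|euler h k - euler h m| <= M * (`|k%:R - m%:R| * h).
Proof.
move=> h0 GM; wlog mk : m k / (m <= k)%N => [wl|].
  by have [/wl//|/ltnW/wl] := leqP m k; rewrite distrC [in `|_ - _| * _]distrC.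
have := @euler_dist h 0 M m k h0 mk; rewrite scaler0 subr0 ger0_norm; last first.
  by rewrite subr_ge0 ler_nat.
by apply => j _; rewrite subr0.
Qed.

(* Step-function Euler approximations: their pointwise limit along an ultrafilter
   inherits the discrete estimate [euler_dist], which is all that is needed to
   differentiate it; no uniform convergence and no integral equation enter. *)
Lemma peano (M : R) :
  (forall t z, `|G t z| <= M) ->
  (forall t z (e : R), 0 < e -> exists2 d : R, 0 < d &
     forall s z', `|s - t| < d -> `|z' - z| < d -> `|G s z' - G t z| <= e) ->
  exists y : R -> 'rV[R]_N, [/\ y 0 = x0,
    forall t : R, 0 < t -> is_derive t 1 y (G t (y t)) &
    forall (w : 'rV[R]_N) (r : R), (forall t z, `|G t z - w| <= r) ->
      forall s t : R, 0 <= s <= t -> `|y t - y s - (t - s) *: w| <= r * (t - s)].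
Proof.
move=> GM Gc.
have M0 : 0 <= M by apply: le_trans (GM 0 0).
have [U [UU ooU]] := ultraFilterLemma eventually_filter.
have PU : ProperFilter U by exact: ultra_proper.
pose h n : R := n.+1%:R^-1.
have h0 n : 0 < h n by rewrite invr_gt0.
have hU : h n @[n --> U] --> (0 : R).
  exact: cvg_trans (cvg_app _ ooU) (@cvg_harmonic R).
(* The number of full steps of length [h n] that fit into [[0, t]]. *)
pose k n (t : R) := Num.trunc (t * n.+1%:R).
have kP n (t : R) : 0 <= t -> t - h n < (k n t)%:R * h n <= t.
  move=> t0; have /truncn_itv/andP[] : 0 <= t * n.+1%:R by exact: mulr_ge0.
  rewrite -/(k n t) => kt tk; rewrite ltrBlDr -{2}(mul1r (h n)) -mulrDl.
  by rewrite /h ltr_pdivlMr// natr1 tk ler_pdivrMr.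
have kle n (s t : R) : s <= t -> (k n s <= k n t)%N.
  by move=> st; apply: le_truncn; exact: ler_wpM2r.
have kU (t : R) : 0 <= t -> (k n t)%:R * h n @[n --> U] --> t.
  move=> t0; apply: (@squeeze_cvgr _ _ _ _ (fun n => t - h n) (cst t)).
  - by apply: nearW => n; have /andP[/ltW -> ->] := kP n _ t0.
  - by rewrite -[X in _ --> X]subr0; apply: cvgB => //; exact: cvg_cst.
  - exact: cvg_cst.
pose x n (t : R) := euler (h n) (k n t).
(* The condition [0 <= t] sits under the existential so that choice yields a total [y]. *)
have xcvg (t : R) : exists l : 'rV[R]_N, 0 <= t -> x n t @[n --> U] --> l.
  have [t0|nt0] := leP 0 t; last by exists 0.
  have [|l xl] := @ultra_bounded_cvg _ _ U (fun n => x n t) (`|x0| + M * t) UU;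
    last by exists l.
  apply: nearW => n; rewrite -[x n t](subrK x0) addrC.
  apply: (le_trans (ler_normD _ _)); rewrite lerD2l.
  have /= := @euler_lipschitz (h n) M 0 (k n t) (ltW (h0 n)) GM.
  move=> /le_trans; apply; apply: ler_wpM2l => //.
  by rewrite subr0 ger0_norm//; have /andP[_ ] := kP n _ t0.
have [y yP] := choice xcvg.
(* The discrete estimate passes to the limit; it looks at the field only at the nodes between [s]
   and [t]. *)
have key w r (s t : R) : 0 <= s <= t ->
    (\forall n \near U, forall j, (k n s <= j < k n t)%N ->
       `|G (j%:R * h n) (euler (h n) j) - w| <= r) ->
    `|y t - y s - (t - s) *: w| <= r * (t - s).
  move=> /andP[s0 st] Gw; have t0 := le_trans s0 st.
  pose d n := (k n t)%:R * h n - (k n s)%:R * h n.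
  have dU : d n @[n --> U] --> t - s by apply: cvgB; exact: kU.
  apply: (@ler_cvg_to _ U PU R (fun n => `|x n t - x n s - d n *: w|)
    (fun n => r * d n)).
  - apply: cvg_norm; apply: cvgB; first by apply: cvgB; exact: yP.
    exact: cvgZr_tmp.
  - by apply: cvgMl_tmp.
  - apply: filterS Gw => n Gw; rewrite /d -mulrBl.
    exact: euler_dist (ltW (h0 n)) (kle _ _ _ st) Gw.
exists y; split.
- have x00 : (x n 0) @[n --> U] --> x0.
    have -> : (fun n => x n 0) = cst x0.
      by apply/funext => n; rewrite /x /k mul0r truncn0.
    exact: cvg_cst.
  by apply: (cvg_unique _ (yP _ (lexx 0)) x00).
- move=> t t0; set w := G t (y t).
  have loc (e : R) : 0 < e -> exists2 d : R, 0 < d & forall s : R, 0 <= s -> `|s - t| < d ->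
      `|y s - y t - (s - t) *: w| <= e * `|s - t|.
    move=> e0; have [d d0 Gd] := Gc t (y t) e e0.
    (* This makes both [d'] and [M * d'] at most [d / 4]: nodes stay within [2 * d'] of [t], and
       their Euler values within [d / 4 + 3 * M * d'] of [y t]. *)
    pose d' := d / 4 / (M + 1).
    have M1 : 0 < M + 1 by rewrite ltr_wpDl.
    have d'0 : 0 < d' by rewrite divr_gt0// divr_gt0.
    have d'M : M * d' <= d / 4.
      by rewrite mulrCA ler_piMr// ?divr_ge0// ?ltW// ltr_pdivrMr// mul1r ltrDl.
    have d'd : d' <= d / 4.
      by rewrite /d' ler_pdivrMr// ler_peMr// ?lerDr// divr_ge0// ltW.
    exists d' => // s s0 std.
    have near_st (a b : R) : 0 <= a -> a <= b -> t - d' < a -> b < t + d' -> a <= t <= b ->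
      (\forall n \near U, forall j, (k n a <= j < k n b)%N ->
         `|G (j%:R * h n) (euler (h n) j) - w| <= e).
      move=> a0 ab ta bt /andP[at' tb]; near=> n => j /andP[aj jb].
      have hd' : h n < d'.
        have : `|0 - h n| < d' by near: n; exact: cvgr_dist_lt.
        by rewrite sub0r normrN gtr0_norm.
      have xyt : `|y t - x n t| < d / 4.
        by near: n; apply: cvgr_dist_lt; [exact: yP (ltW t0)|exact: divr_gt0].
      have /andP[ka _] := kP n _ a0.
      have /andP[_ kb] := kP n _ (le_trans a0 ab).
      have jha : (k n a)%:R * h n <= j%:R * h n by rewrite ler_pM2r// ler_nat.
      have jhb : j%:R * h n <= (k n b)%:R * h n by rewrite ler_pM2r// ler_nat ltnW.
      have /andP[kt kt'] := kP n _ (ltW t0).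
      apply: Gd.
        by rewrite ltr_norml; apply/andP; split; lra.
      rewrite -(subrK (x n t) (euler _ _)) -addrA.
      apply: (le_lt_trans (ler_normD _ _)).
      have : `|euler (h n) j - x n t| <= M * (3 * d').
        apply: (le_trans (euler_lipschitz _ _ (ltW (h0 n)) GM)).
        apply: ler_wpM2l => //; rewrite -(gtr0_norm (h0 n)) -normrM mulrBl.
        by rewrite ler_norml; apply/andP; split; lra.
      rewrite [`|x n t - _|]distrC; have : M * (3 * d') <= 3 * (d / 4) by lra.
      lra.
    move: std; rewrite ltr_norml => /andP[std1 std2].
    have [st|ts] := leP s t.
      rewrite -normrN [in leRHS]distrC (ger0_norm (_ : 0 <= t - s)) ?subr_ge0//.
      have -> : - (y s - y t - (s - t) *: w) = y t - y s - (t - s) *: w.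
        by apply/rowP => i; rewrite !mxE; ring.
      apply: key; first by rewrite s0.
      by apply: near_st => //; [lra|lra|rewrite st lexx].
    rewrite (gtr0_norm (_ : 0 < s - t)) ?subr_gt0//.
    apply: key; first by rewrite (ltW t0) ltW.
    by apply: near_st => //; [exact: ltW|exact: ltW|lra|lra|rewrite lexx ltW].
  have dq : (fun u => u^-1 *: ((y \o shift t) (u *: 1) - y t)) @ 0^' --> w.
    apply/cvgrPdist_le => e e0; have [d d0 yd] := loc e e0.
    near=> u.
    have u0 : u != 0 by near: u; exact: nbhs_dnbhs_neq.
    have ud : `|u| < d by near: u; exact: dnbhs0_lt.
    (* Keeps [u + t] in the half-line on which [loc] controls [y]. *)
    have ut : `|u| < t by near: u; exact: dnbhs0_lt.
    rewrite /= [u *: 1]mulr1.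
    have := yd (u + t); rewrite addrK => /(_ _ ud) yu.
    have {yu} : `|y (u + t) - y t - u *: w| <= e * `|u|.
      by apply: yu; move: ut; rewrite ltr_norml => /andP[]; lra.
    rewrite -(ler_pM2l (_ : 0 < `|u|^-1)) ?invr_gt0 ?normr_gt0//.
    rewrite -normfV -normrZ mulrCA [X in _ <= _ * X]mulrC normfV.
    rewrite mulfV ?normr_eq0// mulr1 distrC scalerBr scalerA mulVf// scale1r.
    by rewrite distrC.
  by apply: DeriveDef; [apply/cvg_ex; exists w|exact: cvg_lim dq].
- move=> w r Gw s t st; apply: key => //; apply: nearW => n j _; exact: Gw.
Unshelve. all: by end_near. Qed.

End peano.

(** * Euclidean norm against the ambient sup norm *)

Section euclidean_norm.
Context {R : realType} {N : nat}.
Implicit Types u v : 'rV[R]_N.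

(** Nearest points are measured by this square because the sup norm is not strictly convex in
    general. *)
Definition sqnorm v : R := \sum_(i < N) v ord0 i ^+ 2.

Lemma normrv_le v (r : R) : 0 <= r -> (`|v| <= r) = [forall i, `|v ord0 i| <= r].
Proof.
move=> r0; rewrite [`|v|]mx_normrE; apply/idP/forallP => [vr i|vr].
  by apply: le_trans vr; exact: (le_bigmax _ (fun ij => `|v ij.1 ij.2|) (ord0, i)).
by apply: bigmax_le => // -[i j] _ /=; rewrite (ord1 i).
Qed.

Lemma sqnorm_ge0 v : 0 <= sqnorm v.
Proof. by apply: sumr_ge0 => i _; exact: sqr_ge0. Qed.

Lemma sqnorm_eq0 v : sqnorm v = 0 -> v = 0.
Proof.
move=> /eqP; rewrite psumr_eq0 => [/allP v0|i _]; last exact: sqr_ge0.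
apply/rowP => i; rewrite mxE; apply/eqP; rewrite -sqrf_eq0.
by have := v0 i; rewrite mem_index_enum => /(_ isT).
Qed.

Lemma sqr_norm_le_sqnorm v : `|v| ^+ 2 <= sqnorm v.
Proof.
rewrite -(sqr_sqrtr (sqnorm_ge0 v)) lerXn2r ?nnegrE ?sqrtr_ge0//.
rewrite normrv_le ?sqrtr_ge0//; apply/forallP => i.
rewrite -sqrtr_sqr ler_wsqrtr// /sqnorm (bigD1 i)//= lerDl.
by apply: sumr_ge0 => j _; exact: sqr_ge0.
Qed.

Lemma norm_le_enorm v : `|v| <= enorm v.
Proof.
rewrite -(@ler_pXn2r _ 2) ?nnegrE ?sqrtr_ge0// sqr_sqrtr ?sqnorm_ge0//.
exact: sqr_norm_le_sqnorm.
Qed.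

Lemma enorm_le_norm v : enorm v <= Num.sqrt N%:R * `|v|.
Proof.
rewrite -[`|v|]ger0_norm// -sqrtr_sqr -sqrtrM ?ler0n// ler_wsqrtr//.
rewrite [leRHS](_ : _ = \sum_(i < N) `|v| ^+ 2); last first.
  by rewrite sumr_const card_ord mulr_natl.
apply: ler_sum => i _; rewrite -real_normK ?num_real// lerXn2r ?nnegrE//.
by have := lexx `|v|; rewrite normrv_le// => /forallP.
Qed.

Lemma sqnorm_cvg (F : set_system nat) (u : nat -> 'rV[R]_N) v : Filter F ->
  u n @[n --> F] --> v -> sqnorm (u n) @[n --> F] --> sqnorm v.
Proof.
move=> FF uv; apply: (@cvg_big _ _ +%R) => //; first exact: add_continuous.
move=> i _; apply: cvgM; exact: (cvg_comp _ _ uv (@coord_continuous _ _ _ _ _ _)).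
Qed.

Lemma sqnorm_convex u v (l : R) : 0 <= l <= 1 ->
  sqnorm (l *: u + (1 - l) *: v) <= l * sqnorm u + (1 - l) * sqnorm v.
Proof.
move=> /andP[l0 l1]; rewrite /sqnorm !mulr_sumr -big_split/=.
apply: ler_sum => i _; rewrite !mxE -subr_ge0.
rewrite [leRHS](_ : _ = l * (1 - l) * (u ord0 i - v ord0 i) ^+ 2); last by ring.
by rewrite mulr_ge0 ?sqr_ge0// mulr_ge0// subr_ge0.
Qed.

(** The parallelogram identity, source of the uniqueness of nearest points. *)
Lemma sqnorm_midpoint u v :
  sqnorm (2^-1 *: u + (1 - 2^-1) *: v) = (sqnorm u + sqnorm v) / 2 - sqnorm (u - v) / 4.
Proof.
rewrite /sqnorm -big_split/= !mulr_suml -sumrB; apply: eq_bigr => i _.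
by rewrite !mxE; field.
Qed.

End euclidean_norm.

(** * Nearest points of velocity sublevel sets and their continuity *)

Section nearest_point_selection.
Context {R : realType} {N : nat}.
Variables (T : R) (L : R -> 'rV[R]_N -> 'rV[R]_N -> \bar R).
Hypothesis L1 : lsc_L T L.
Hypothesis L2 : forall t x, 0 <= t <= T -> econvex (L t x) /\ eproper (L t x).
Hypothesis L3 : forall t x v (tn : nat -> R) (xn : nat -> 'rV[R]_N),
  0 <= t <= T -> (forall n, 0 <= tn n <= T) ->
  tn @ \oo --> t -> xn @ \oo --> x ->
  exists vn : nat -> 'rV[R]_N, vn @ \oo --> v /\
    (fun n => L (tn n) (xn n) (vn n)) @ \oo --> L t x v.
Variables (v0 : 'rV[R]_N) (c : R).

(** The metric projection of [v0], kept as a relation since the sublevel set may be empty. *)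
Definition nearest (t : R) (x v : 'rV[R]_N) : Prop :=
  (L t x v <= c%:E)%E /\
  forall u, (L t x u <= c%:E)%E -> sqnorm (v - v0) <= sqnorm (u - v0).

(** If [c < L] at the limit, (L1) gives [c < L] nearby, against the bound along [F]. The filter is
    general so as to cover ultrafilters. *)
Lemma sublevel_closed (F : set_system nat) (tn : nat -> R) (xn vn : nat -> 'rV[R]_N) t x v :
  ProperFilter F -> 0 <= t <= T -> (forall n, 0 <= tn n <= T) ->
  tn n @[n --> F] --> t -> xn n @[n --> F] --> x -> vn n @[n --> F] --> v ->
  (\forall n \near F, (L (tn n) (xn n) (vn n) <= c%:E)%E) -> (L t x v <= c%:E)%E.
Proof.
move=> PF tT tnT tnt xnx vnv Lc; rewrite leNgt; apply/negP => cL.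
have [U Up UL] := @L1 ((t, x), v) c tT cL.
have nU : \forall n \near F, U ((tn n, xn n), vn n).
  exact: (cvg_pair (cvg_pair tnt xnx) vnv Up).
have [n [Ln Un]] := filter_ex (filterI Lc nU).
by have := UL _ Un (tnT n); rewrite ltNge Ln.
Qed.

(** Rests on the crude fact that [r^2 <= b] implies [r <= 1 + b]. *)
Lemma norm_le_of_sqnorm (u : 'rV[R]_N) (b : R) :
  sqnorm (u - v0) <= b -> `|u| <= `|v0| + (1 + b).
Proof.
move=> ub; rewrite -[u](subrK v0) addrC; apply: (le_trans (ler_normD _ _)).
rewrite lerD2l; have := sqr_norm_le_sqnorm (u - v0); rewrite expr2.
by have := normr_ge0 (u - v0); nra.
Qed.

(** A minimizing sequence is bounded, and its ultrafilter limit stays in the closed sublevel set. *)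
Lemma nearest_exists t x u : 0 <= t <= T -> (L t x u <= c%:E)%E ->
  exists v, nearest t x v.
Proof.
move=> tT Lu; pose E := [set sqnorm (v - v0) | v in [set v | (L t x v <= c%:E)%E]].
have E0 : lbound E 0 by move=> _ [v _ <-]; exact: sqnorm_ge0.
have hE : has_inf E by split; [exists (sqnorm (u - v0)), u|exists 0].
have ex n : exists v, (L t x v <= c%:E)%E /\ sqnorm (v - v0) <= inf E + n.+1%:R^-1.
  have [_ [v Lv <-] /ltW vE] := @inf_adherent _ E n.+1%:R^-1 ltac:(by rewrite invr_gt0) hE.
  by exists v.
have [w wP] := choice ex.
have [U [UU ooU]] := ultraFilterLemma eventually_filter.
have PU : ProperFilter U by exact: ultra_proper.
have [|l wl] := @ultra_bounded_cvg _ _ U w (`|v0| + (1 + (inf E + 1))) UU.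
  apply: nearW => n; apply: norm_le_of_sqnorm; apply: (le_trans (wP n).2).
  by rewrite lerD2l invf_le1// ler1n.
exists l; split.
  apply: (@sublevel_closed U (fun=> t) (fun=> x) w) => //;
    [exact: cvg_cst|exact: cvg_cst|].
  by apply: nearW => n; exact: (wP n).1.
move=> v Lv; apply: (@le_trans _ _ (inf E)); last by apply: ge_inf; [exists 0|exists v].
apply: (@ler_cvg_to _ U PU R (fun n => sqnorm (w n - v0)) (fun n => inf E + n.+1%:R^-1)).
- by apply: sqnorm_cvg; apply: cvgB => //; exact: cvg_cst.
- rewrite -[X in _ --> X]addr0; apply: cvgD; first exact: cvg_cst.
  exact: cvg_trans (cvg_app _ ooU) (@cvg_harmonic R).
- by apply: nearW => n; exact: (wP n).2.
Qed.

(** Separate levels [a] and [b] let one strictly admissible velocity bring the whole combination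
    strictly below [c]. *)
Lemma sublevel_convex t x u v (l : R) (a b : R) : 0 <= t <= T -> 0 < l < 1 ->
  (L t x u <= a%:E)%E -> (L t x v <= b%:E)%E ->
  (L t x (l *: u + (1 - l) *: v) <= (l * a + (1 - l) * b)%:E)%E.
Proof.
move=> tT l01 ua vb; have [/(_ u v l l01) cvx _] := L2 x tT.
have /andP[l0 l1] := l01.
apply: (le_trans cvx); rewrite [leRHS]EFinD !EFinM; apply: leeD.
  by apply: lee_wpmul2l => //; rewrite lee_fin ltW.
by apply: lee_wpmul2l => //; rewrite lee_fin subr_ge0 ltW.
Qed.

(** The midpoint of two distinct nearest points would be admissible and strictly closer to [v0]. *)
Lemma nearest_unique t x u v : 0 <= t <= T -> nearest t x u -> nearest t x v -> u = v.
Proof.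
move=> tT [Lu minu] [Lv minv].
have half : 0 < (2^-1 : R) < 1 by rewrite invr_gt0 ltr0n/= invf_lt1 ?ltr1n.
have Lm := sublevel_convex tT half Lu Lv.
have uv : sqnorm (u - v0) = sqnorm (v - v0).
  by apply/eqP; rewrite eq_le minu// minv.
have := minu (2^-1 *: u + (1 - 2^-1) *: v).
rewrite (_ : (_ * c + _ * c) = c) in Lm; last by field.
move=> /(_ Lm).
have -> : 2^-1 *: u + (1 - 2^-1) *: v - v0 =
    2^-1 *: (u - v0) + (1 - 2^-1) *: (v - v0).
  by apply/rowP => i; rewrite !mxE; field.
rewrite sqnorm_midpoint -uv.
have -> : u - v0 - (v - v0) = u - v by apply/rowP => i; rewrite !mxE; ring.
move=> le; apply/subr0_eq/sqnorm_eq0/eqP; rewrite eq_le sqnorm_ge0 andbT.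
by move: le; lra.
Qed.

(* The nearest point [v] of the sublevel set is pushed slightly towards the strict
   point [v'], so that (L3) carries it to the neighbouring sublevel sets. *)
Lemma nearest_cvg (U : set_system nat) (tn : nat -> R) (xn vn : nat -> 'rV[R]_N) t x v v' :
  UltraFilter U -> \oo `<=` U -> 0 <= t <= T -> (forall n, 0 <= tn n <= T) ->
  tn @ \oo --> t -> xn @ \oo --> x ->
  (forall n, nearest (tn n) (xn n) (vn n)) -> nearest t x v ->
  (L t x v' < c%:E)%E -> vn n @[n --> U] --> v.
Proof.
move=> UU ooU tT tnT tnt xnx vnP vP Lv'.
have PU : ProperFilter U by exact: ultra_proper.
have [c' Lc' c'c] : exists2 c', (L t x v' <= c'%:E)%E & c' < c.
  have [_ [/(_ v') nNy _]] := L2 x tT.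
  case: (L t x v') Lv' nNy => [r|//|//]; rewrite lte_fin => rc _.
  by exists r.
have push (l : R) : 0 < l < 1 ->
    exists2 wn : nat -> 'rV[R]_N, wn @ \oo --> l *: v' + (1 - l) *: v &
      \forall n \near \oo, sqnorm (vn n - v0) <= sqnorm (wn n - v0).
  move=> l01; have Lw := sublevel_convex tT l01 Lc' vP.1.
  have [wn [wnw Lwn]] := L3 (l *: v' + (1 - l) *: v) tT tnT tnt xnx.
  exists wn => //; have Lwc : (L t x (l *: v' + (1 - l) *: v)%R < c%:E)%E.
    by apply: (le_lt_trans Lw); rewrite lte_fin; nra.
  have : \forall n \near \oo, (L (tn n) (xn n) (wn n) < c%:E)%E.
    exact: (Lwn _ (open_ereal_lt' Lwc)).
  by apply: filterS => n /ltW; exact: (vnP n).2.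
have half : 0 < (2^-1 : R) < 1 by rewrite invr_gt0 ltr0n/= invf_lt1 ?ltr1n.
have cvgsq (wn : nat -> 'rV[R]_N) (w : 'rV[R]_N) : wn @ \oo --> w ->
    sqnorm (wn n - v0) @[n --> U] --> sqnorm (w - v0).
  move=> wnw; apply: sqnorm_cvg; apply: cvgB; last exact: cvg_cst.
  exact: cvg_trans (cvg_app _ ooU) wnw.
(* Any fixed weight would do here: one convergent [wn] bounds [vn]. *)
have [l vnl] : exists l : 'rV[R]_N, vn n @[n --> U] --> l.
  have [wn wnw wnv] := push _ half.
  have ltrDr1 (a : R) : a < a + 1 by rewrite ltrDl.
  apply: (@ultra_bounded_cvg _ _ U vn _ UU).
  have b := cvgr_lt _ (cvgsq _ _ wnw) _ (ltrDr1 _).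
  near=> n; apply: norm_le_of_sqnorm.
  apply: (@le_trans _ _ (sqnorm (wn n - v0))); first by near: n; exact: ooU.
  by apply: ltW; near: n; exact: b.
(* By uniqueness it suffices that [l] is itself nearest at [(t, x)]. *)
suff -> : v = l by [].
apply: (nearest_unique tT vP); split.
  apply: (@sublevel_closed U tn xn vn) => //.
  - exact: cvg_trans (cvg_app _ ooU) tnt.
  - exact: cvg_trans (cvg_app _ ooU) xnx.
  - by apply: nearW => n; exact: (vnP n).1.
move=> u /(vP.2 u) vu; apply: le_trans vu.
have le_push (a : R) : 0 < a < 1 ->
    sqnorm (l - v0) <= a * sqnorm (v' - v0) + (1 - a) * sqnorm (v - v0).
  move=> a01; have [wn wnw wnv] := push _ a01.
  apply: (@le_trans _ _ (sqnorm (a *: v' + (1 - a) *: v - v0))).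
    apply: (@ler_cvg_to _ U PU R (fun n => sqnorm (vn n - v0)) (fun n => sqnorm (wn n - v0))).
    - by apply: sqnorm_cvg; apply: cvgB => //; exact: cvg_cst.
    - exact: cvgsq.
    - exact: ooU.
  have -> : a *: v' + (1 - a) *: v - v0 = a *: (v' - v0) + (1 - a) *: (v - v0).
    by apply/rowP => i; rewrite !mxE; ring.
  by apply: sqnorm_convex; have /andP[/ltW -> /ltW ->] := a01.
apply/ler_addgt0Pr => e e0.
set A := sqnorm (v' - v0) in le_push; have A0 : 0 <= A by exact: sqnorm_ge0.
set B := sqnorm (v - v0) in le_push *; have B0 : 0 <= B by exact: sqnorm_ge0.
have D0 : 0 < A + e + 1 by lra.
(* This weight lies in [(0, 1)] and its product with [A] is at most [e]. *)
have aD : e / (A + e + 1) * (A + e + 1) = e by rewrite divfK// gt_eqF.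
have a0 : 0 < e / (A + e + 1) by exact: divr_gt0.
have := le_push (e / (A + e + 1)); set a := e / (A + e + 1) in aD a0 *.
have a1 : a < 1 by rewrite /a ltr_pdivrMr// mul1r; lra.
rewrite a0 a1 => /(_ isT) /le_trans; apply; nra.
Unshelve. all: by end_near. Qed.

(** Along a sequence of counterexamples tending to [(t0, x0)], (L3) at [v0] would supply velocities
    tending to [v0] with cost eventually below [c]. *)
Lemma strict_sublevel_near t0 x0 (e : R) : 0 <= t0 <= T -> (L t0 x0 v0 < c%:E)%E -> 0 < e ->
  exists2 d : R, 0 < d & forall t x, 0 <= t <= T -> `|t - t0| < d -> `|x - x0| < d ->
    exists2 v, (L t x v < c%:E)%E & sqnorm (v - v0) < e.
Proof.
move=> t0T Lc e0; apply: contrapT => nex.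
have ex n : exists p : R * 'rV[R]_N, [/\ 0 <= p.1 <= T, `|p.1 - t0| < n.+1%:R^-1,
    `|p.2 - x0| < n.+1%:R^-1 &
    ~ exists2 v, (L p.1 p.2 v < c%:E)%E & sqnorm (v - v0) < e].
  apply: contrapT => nexn; apply: nex; exists n.+1%:R^-1; first by rewrite invr_gt0.
  move=> t x tT td xd; apply: contrapT => nv; apply: nexn.
  by exists (t, x).
have [p pP] := choice ex.
have c1 : (fun n => (p n).1) @ \oo --> t0.
  apply/cvgrPdist_lt => eps eps0; near=> n; rewrite distrC.
  have [_ /lt_trans + _ _] := pP n; apply.
  by near: n; exact: (near_infty_natSinv_lt (PosNum eps0)).
have c2 : (fun n => (p n).2) @ \oo --> x0.
  apply/cvgrPdist_lt => eps eps0; near=> n; rewrite distrC.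
  have [_ _ /lt_trans + _] := pP n; apply.
  by near: n; exact: (near_infty_natSinv_lt (PosNum eps0)).
have [vn [vnv Lvn]] := L3 v0 t0T (fun n => let: And4 h _ _ _ := pP n in h) c1 c2.
have n1 : \forall n \near \oo, (L (p n).1 (p n).2 (vn n) < c%:E)%E.
  exact: (Lvn _ (open_ereal_lt' Lc)).
have n2 : \forall n \near \oo, sqnorm (vn n - v0) < e.
  have /cvgr_lt : sqnorm (vn n - v0) @[n --> \oo] --> sqnorm (0 : 'rV[R]_N).
    rewrite -(subrr v0); apply: sqnorm_cvg; apply: cvgB => //; exact: cvg_cst.
  apply; rewrite /sqnorm big1// => i _; by rewrite mxE expr0n.
have [n [Ln sn]] := filter_ex (filterI n1 n2).
by have [_ _ _] := pP n; apply; exists (vn n).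
Unshelve. all: by end_near. Qed.

(** The strictly admissible velocities near [v0] serve twice: they keep the nearest point within [e]
    of [v0], and they are the strict points that [nearest_cvg] asks for. *)
Lemma continuous_selection t0 x0 (e : R) : 0 <= t0 <= T -> (L t0 x0 v0 < c%:E)%E -> 0 < e ->
  exists2 d : R, 0 < d & exists f : R -> 'rV[R]_N -> 'rV[R]_N,
  forall t x, 0 <= t <= T -> `|t - t0| < d -> `|x - x0| < d ->
  [/\ (L t x (f t x) <= c%:E)%E, `|f t x - v0| <= e &
    forall eps : R, 0 < eps -> exists2 r : R, 0 < r &
      forall s y, 0 <= s <= T -> `|s - t0| < d -> `|y - x0| < d ->
        `|s - t| < r -> `|y - x| < r -> `|f s y - f t x| <= eps].
Proof.
move=> t0T Lc e0; have [d d0 dP] := strict_sublevel_near t0T Lc (exprn_gt0 2 e0).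
exists d => //.
have ex (p : R * 'rV[R]_N) : exists v, 0 <= p.1 <= T -> `|p.1 - t0| < d ->
    `|p.2 - x0| < d -> nearest p.1 p.2 v.
  apply: contrapT => nex.
  have nex' v : ~ (0 <= p.1 <= T -> `|p.1 - t0| < d -> `|p.2 - x0| < d ->
    nearest p.1 p.2 v) by move=> nv; apply: nex; exists v.
  apply: (nex' 0) => pT pt px; have [v /ltW Lv _] := dP _ _ pT pt px.
  have [w wP] := nearest_exists pT Lv.
  by exfalso; apply: (nex' w).
have [f fP] := choice ex.
exists (fun t x => f (t, x)) => t x tT td xd; have ftx := fP (t, x) tT td xd.
have [v Lv ve] := dP _ _ tT td xd.
split; first exact: ftx.1.
  rewrite -(@ler_pXn2r _ 2) ?nnegrE ?(ltW e0)//.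
  apply: (le_trans (sqr_norm_le_sqnorm _)); apply: (le_trans _ (ltW ve)).
  by apply: ftx.2; exact: ltW.
(* A failure of continuity gives points [p n] tending to [(t, x)] whose nearest points stay [eps]
   away, against [nearest_cvg]. *)
move=> eps eps0; apply: contrapT => nex.
have exn n : exists p : R * 'rV[R]_N,
    [/\ [/\ 0 <= p.1 <= T, `|p.1 - t0| < d & `|p.2 - x0| < d],
    `|p.1 - t| < n.+1%:R^-1, `|p.2 - x| < n.+1%:R^-1 & eps < `|f p - f (t, x)|].
  apply: contrapT => nexn; apply: nex; exists n.+1%:R^-1; first by rewrite invr_gt0.
  move=> s y sT sd yd st yx; rewrite leNgt; apply/negP => lt; apply: nexn.
  by exists (s, y).
have [p pP] := choice exn.
have c1 : (fun n => (p n).1) @ \oo --> t.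
  apply/cvgrPdist_lt => b b0; near=> n; rewrite distrC.
  have [_ /lt_trans + _ _] := pP n; apply.
  by near: n; exact: (near_infty_natSinv_lt (PosNum b0)).
have c2 : (fun n => (p n).2) @ \oo --> x.
  apply/cvgrPdist_lt => b b0; near=> n; rewrite distrC.
  have [_ _ /lt_trans + _] := pP n; apply.
  by near: n; exact: (near_infty_natSinv_lt (PosNum b0)).
have [U [UU ooU]] := ultraFilterLemma eventually_filter.
have PU : ProperFilter U by exact: ultra_proper.
have pT n : 0 <= (p n).1 <= T by have [[]] := pP n.
have fnP n : nearest (p n).1 (p n).2 (f (p n)) by have [[h1 h2 h3] _ _ _] := pP n; exact: fP.
have := nearest_cvg UU ooU tT pT c1 c2 fnP ftx Lv.
move=> /cvgr_dist_le /(_ _ eps0) /filter_ex [n].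
by rewrite distrC leNgt; have [_ _ _ ->] := pP n.
Unshelve. all: by end_near. Qed.

End nearest_point_selection.

(** * Absolute continuity of Lipschitz arcs and of concatenations *)

Section absolute_continuity.
Context {R : realType} {N : nat}.

Lemma abs_cont_on_lipschitz (a b M : R) (x : R -> 'rV[R]_N) : 0 <= M ->
  (forall s t, a <= s -> s <= t -> t <= b -> `|x t - x s| <= M * (t - s)) ->
  abs_cont_on a b x.
Proof.
move=> M0 xM eps eps0; pose K := Num.sqrt N%:R * M + 1.
have K0 : 0 < K by rewrite ltr_wpDl// mulr_ge0// sqrtr_ge0.
exists (eps / K); first exact: divr_gt0.
move=> n I Iab _; rewrite ltr_pdivlMr// => Ieps.
apply: (le_lt_trans _ Ieps); rewrite mulr_suml; apply: ler_sum => i _.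
have [aI [II Ib]] := Iab i.
apply: (le_trans (enorm_le_norm _)).
apply: (@le_trans _ _ (Num.sqrt N%:R * (M * ((I i).2 - (I i).1)))).
  by apply: ler_wpM2l; [exact: sqrtr_ge0|exact: xM].
rewrite mulrA mulrC; apply: ler_wpM2l; first by rewrite subr_ge0.
by rewrite lerDl.
Qed.

Lemma abs_cont_on_cst (a b : R) (x0 : 'rV[R]_N) : abs_cont_on a b (cst x0).
Proof.
by apply: (@abs_cont_on_lipschitz _ _ 0) => // s t _ _ _; rewrite subrr normr0 mul0r.
Qed.

(** Truncating endpoints at [m] by min and max splits each interval in two; it lengthens none and
    creates no overlap. *)
Lemma abs_cont_on_cat (a m b : R) (x w : R -> 'rV[R]_N) : a <= m <= b ->
  abs_cont_on a m x -> abs_cont_on m b w -> x m = w m ->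
  abs_cont_on a b (fun t => if t < m then x t else w t).
Proof.
have min_shrink (p q : R) : p <= q -> Num.min q m - Num.min p m <= q - p.
  by have [?|?] := ltP p m; have [?|?] := ltP q m; lra.
have max_shrink (p q : R) : p <= q -> Num.max q m - Num.max p m <= q - p.
  by have [?|?] := ltP p m; have [?|?] := ltP q m; lra.
move=> /andP[am mb] xac wac xw eps eps0; pose K := 2 * (Num.sqrt N%:R + 1) : R.
have s0 : 0 <= Num.sqrt N%:R :> R by exact: sqrtr_ge0.
have K0 : 0 < K by rewrite mulr_gt0// ltr_wpDl.
have epsK : 0 < eps / K by exact: divr_gt0.
have [d1 d10 xd] := xac _ epsK; have [d2 d20 wd] := wac _ epsK.
exists (Num.min d1 d2); first by rewrite lt_min d10.
move=> n I Iab Idisj; rewrite lt_min => /andP[Id1 Id2].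
pose J i := (Num.min (I i).1 m, Num.min (I i).2 m).
pose J' i := (Num.max (I i).1 m, Num.max (I i).2 m).
pose z t := if t < m then x t else w t.
(* Turns every increment of [z] into one of [x] plus one of [w], wherever [m] lies. *)
have zE t : z t = x (Num.min t m) + w (Num.max t m) - w m.
  rewrite /z; have [tm|mt] := ltP t m; first by rewrite addrK.
  by rewrite xw [w m + _]addrC addrK.
have xJ : \sum_(i < n) enorm (x (J i).2 - x (J i).1) < eps / K.
  apply: xd.
  - move=> i; have [aI [II Ib]] := Iab i.
    split; first by rewrite le_min aI.
    by split; [exact: le_min2|rewrite ge_min lexx orbT].
  - by move=> i j /Idisj[?|?]; [left|right]; exact: le_min2.
  - apply: le_lt_trans Id1; apply: ler_sum => i _; have [_ [II _]] := Iab i.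
    exact: min_shrink.
have wJ : \sum_(i < n) enorm (w (J' i).2 - w (J' i).1) < eps / K.
  apply: wd.
  - move=> i; have [aI [II Ib]] := Iab i.
    split; first by rewrite le_max lexx orbT.
    by split; [exact: le_max2|rewrite ge_max Ib].
  - by move=> i j /Idisj[?|?]; [left|right]; exact: le_max2.
  - apply: le_lt_trans Id2; apply: ler_sum => i _; have [_ [II _]] := Iab i.
    exact: max_shrink.
apply: (@le_lt_trans _ _ (Num.sqrt N%:R *
  (\sum_(i < n) enorm (x (J i).2 - x (J i).1) +
   \sum_(i < n) enorm (w (J' i).2 - w (J' i).1)))).
  rewrite -big_split mulr_sumr; apply: ler_sum => i _ /=.
  apply: (le_trans (enorm_le_norm _)); apply: ler_wpM2l => //.
  rewrite -/(z (I i).2) -/(z (I i).1).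
  have -> : z (I i).2 - z (I i).1 =
      (x (J i).2 - x (J i).1) + (w (J' i).2 - w (J' i).1).
    by rewrite !zE; apply/rowP => j; rewrite !mxE; ring.
  by apply: (le_trans (ler_normD _ _)); apply: lerD; exact: norm_le_enorm.
have qK : eps / K * K = eps by rewrite divfK// gt_eqF.
have le2 := ler_wpM2l s0 (lerD (ltW xJ) (ltW wJ)); apply: (le_lt_trans le2).
rewrite -[ltRHS]qK; move: epsK; rewrite /K; move: (eps / _) => q q0; clear -q0.
by lra.
Qed.

End absolute_continuity.

(** * Dynamic programming inequality for the value function *)

Section dynamic_programming.
Local Open Scope ereal_scope.
Context {R : realType} {N : nat}.
Variables (T : R) (L : R -> 'rV[R]_N -> 'rV[R]_N -> \bar R) (g : 'rV[R]_N -> \bar R).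
Let mu := @lebesgue_measure R.

(** Points are null sets. This discards the junction time of a concatenation, where the derivative
    is unknown. *)
Lemma integral_setU1W (a : R) (B : set R) (f : R -> \bar R) : measurable B -> ~ B a ->
  \int[mu]_(t in a |` B) f t = \int[mu]_(t in B) f t.
Proof.
move=> mB Ba; have dB : [disjoint [set a] & B].
  by apply/disj_setPS => t [/= -> ].
rewrite [LHS]integralE [RHS]integralE.
rewrite (@ge0_integral_setUW _ _ _ mu [set a] B f^\+ _ mB dB)//.
rewrite (@ge0_integral_setUW _ _ _ mu [set a] B f^\- _ mB dB)//.
by rewrite !integral_set1 !add0e.
Qed.

Lemma near_optimal_arc (t0 : R) (x0 : 'rV[R]_N) (e : R) : (0 <= t0 <= T)%R ->
  value_fun T L g t0 x0 \is a fin_num -> (0 < e)%R ->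
  exists w : R -> 'rV[R]_N,
  let I := \int[mu]_(t in [set t | t0 <= t <= T]%R) L t (w t) ('D_1 w t) in
    [/\ abs_cont_on t0 T w, w t0 = x0, g (w T) \is a fin_num, I \is a fin_num &
        g (w T) + I <= value_fun T L g t0 x0 + e%:E].
Proof.
move=> /andP[t00 t0T] Vfin e0; have [t0T'|Tt0] := ltP t0 T; last first.
  have {Tt0} t0T : t0 = T by apply/eqP; rewrite eq_le t0T.
  (* At the final time a constant arc works, the integral over a single time being zero. *)
  subst t0; exists (cst x0); move: Vfin; rewrite /value_fun ltxx andbF eqxx => gfin.
  have -> : [set t | T <= t <= T]%R = [set T].
    apply/seteqP; split => t /=; last by move=> ->; rewrite lexx.
    by move=> /andP[? ?]; apply/eqP; rewrite eq_le; apply/andP.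
  rewrite integral_set1 adde0; split => //; first exact: abs_cont_on_cst.
  by rewrite leeDl// lee_fin ltW.
move: (Vfin); rewrite /value_fun t00 t0T' /=.
set S := [set _ | _ in _] => Sfin.
have [_ [w [wac wt0] <-] wS] := lb_ereal_inf_adherent e0 Sfin.
exists w => /=; have Sw : ereal_inf S <= g (w T) +
    \int[mu]_(t in [set t | t0 <= t <= T]%R) L t (w t) ('D_1 w t).
  by apply: ereal_inf_lbound; exists w.
(* The total lies between the finite infimum and that infimum plus [e]; a finite sum has finite
   terms. *)
have : g (w T) + \int[mu]_(t in [set t | t0 <= t <= T]%R) L t (w t) ('D_1 w t) \is a fin_num.
  rewrite fin_numE; apply/andP; split.
    rewrite gt_eqF// (lt_le_trans _ Sw)//.
    by rewrite ltNye_eq Sfin.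
  rewrite lt_eqF// (lt_trans wS)//.
  by rewrite lte_add_pinfty// ?ltry// ltey_eq Sfin.
by rewrite fin_numD => /andP[gfin Ifin]; split => //; exact: ltW.
Qed.

(** Following [z] and then a nearly optimal arc from [x0] is a competitor at [(t1, z t1)], whose
    first piece costs at most [c] per unit of time. *)
Lemma value_fun_backward (t1 t0 c : R) (x0 : 'rV[R]_N) (z : R -> 'rV[R]_N) :
  (0 <= t1)%R -> (t1 < t0)%R -> (t0 <= T)%R -> value_fun T L g t0 x0 \is a fin_num ->
  abs_cont_on t1 t0 z -> z t0 = x0 ->
  (forall t, (t1 <= t < t0)%R -> L t (z t) ('D_1 z t) <= c%:E) ->
  value_fun T L g t1 (z t1) <= value_fun T L g t0 x0 + (c * (t0 - t1))%:E.
Proof.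
move=> t10 t1t0 t0T Vfin zac zt0 Lc; apply/lee_addgt0Pr => e e0.
have [|w [wac wt0 gfin Ifin wV]] := near_optimal_arc _ Vfin e0.
  by rewrite t0T (le_trans t10)// ltW.
pose x t := if (t < t0)%R then z t else w t.
have xac : abs_cont_on t1 T x.
  by apply: abs_cont_on_cat => //; [rewrite t0T ltW|rewrite zt0].
have xT : x T = w T by rewrite /x ltNge t0T.
(* Derivatives are local, so away from [t0] the concatenation has that of the piece it follows. *)
have xlt t : (t < t0)%R -> x t = z t /\ 'D_1 x t = 'D_1 z t.
  move=> tt0; split; first by rewrite /x tt0.
  apply: near_eq_derive; near=> s; rewrite /x ifT//.
  by near: s; exact: lt_nbhsl.
have xgt t : (t0 < t)%R -> x t = w t /\ 'D_1 x t = 'D_1 w t.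
  move=> tt0; split; first by rewrite /x ltNge ltW.
  apply: near_eq_derive; near=> s; rewrite /x ifF//; apply/negbTE; rewrite -leNgt ltW//.
  by near: s; exact: lt_nbhsr.
pose A : set R := `[t1, t0[%classic; pose B : set R := `]t0, T]%classic.
have mA : measurable A by exact: measurable_itv.
have mB : measurable B by exact: measurable_itv.
have dAB : [disjoint A & B].
  apply/disj_setPS => t []; rewrite /A /B /= !in_itv /= => /andP[_ tt0] /andP[t0t _].
  by move: (lt_trans tt0 t0t); rewrite ltxx.
have muA : mu A = (t0 - t1)%:E by rewrite /mu lebesgue_measure_itv /= lte_fin t1t0.
have muAfin : mu A \is a fin_num by rewrite muA.
have BE : [set t | t0 <= t <= T]%R = t0 |` B.
  apply/seteqP; split => t; rewrite /B /= in_itv /=.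
    by rewrite [(t0 <= t)%R]le_eqVlt => /andP[/orP[/eqP ->|-> ->]]; [left|right].
  by move=> [->|/andP[/ltW -> ->]//]; rewrite lexx.
have ABE : [set t | t1 <= t <= T]%R = t0 |` (A `|` B).
  apply/seteqP; split => t; rewrite /A /B /= !in_itv /=.
    move=> /andP[t1t tT]; have [tt0|tt0|->] := ltgtP t t0; last by left.
      by right; left; rewrite t1t.
    by right; right.
  move=> [->|[/andP[-> tt0]|/andP[tt0 ->]]]; first by rewrite t0T ltW.
    by rewrite (le_trans (ltW tt0)).
  by rewrite andbT ltW// (lt_trans t1t0).
have t0B : ~ B t0 by rewrite /B /= in_itv /= ltxx.
have t0AB : ~ (A `|` B) t0 by case=> //; rewrite /A /= in_itv /= ltxx andbF.
have IB : \int[mu]_(t in [set t | t0 <= t <= T]%R) L t (w t) ('D_1 w t) =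
    \int[mu]_(t in B) L t (x t) ('D_1 x t).
  rewrite BE.
  rewrite (@integral_setU1W t0 B _ mB t0B).
  apply: eq_integral => t /set_mem.
  by rewrite /B /= in_itv /= => /andP[/xgt[-> ->]].
apply: (@le_trans _ _ (g (x T) + \int[mu]_(t in [set t | t1 <= t <= T]%R) L t (x t) ('D_1 x t))).
  rewrite {1}/value_fun t10 (lt_le_trans t1t0 t0T) /=; apply: ereal_inf_lbound.
  exists x; last exact: erefl.
  by split; [exact: xac|rewrite /x t1t0].
rewrite ABE (@integral_setU1W t0 _ _ (measurableU _ _ mA mB) t0AB).
rewrite IB in Ifin wV.
have Ic : \int[mu]_(t in A `|` B) L t (x t) ('D_1 x t) <=
    c%:E * mu A + \int[mu]_(t in B) L t (x t) ('D_1 x t).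
  apply: (@integral_setU_le_cst _ _ _ mu A B _ c mA mB dAB muAfin _ Ifin).
  move=> t; rewrite /A /= in_itv /= => /andP[t1t tt0]; have [-> ->] := xlt _ tt0.
  by apply: Lc; rewrite t1t.
rewrite xT; apply: (le_trans (leeD2l _ Ic)).
rewrite muA; move: wV; rewrite -(fineK gfin) -(fineK Ifin) -(fineK Vfin).
by rewrite -EFinM -!EFinD !lee_fin; lra.
Unshelve. all: by end_near. Qed.

End dynamic_programming.

(** * Projection of the line onto an interval *)

Section clamp.
Context {R : realType}.

Definition clamp (lo hi u : R) : R := Num.max lo (Num.min u hi).

Lemma clamp_itv lo hi u : lo <= hi -> lo <= clamp lo hi u <= hi.
Proof. by move=> lh; rewrite /clamp le_max lexx ge_max lh ge_min lexx orbT. Qed.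

Lemma clamp_id lo hi u : lo <= u <= hi -> clamp lo hi u = u.
Proof. by move=> /andP[lu uh]; rewrite /clamp min_l// max_r. Qed.

(** Lets a field precomposed with clamps inherit the modulus of continuity of the original. *)
Lemma clamp_dist lo hi u v : lo <= hi -> `|clamp lo hi u - clamp lo hi v| <= `|u - v|.
Proof.
move=> lh; wlog uv : u v / u <= v => [wl|].
  by have [/wl//|/ltW/wl] := leP u v; rewrite distrC [in leRHS]distrC.
have le : clamp lo hi u <= clamp lo hi v by apply: le_max2 => //; exact: le_min2.
rewrite distrC [leRHS]distrC !ger0_norm ?subr_ge0// /clamp.
have [uh|hu] := leP u hi; have [vh|hv] := leP v hi.
- by have [?|?] := leP lo u; have [?|?] := leP lo v; lra.
- by have [?|?] := leP lo u; have [?|?] := leP lo hi; lra.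
- by have [?|?] := leP lo hi; have [?|?] := leP lo v; lra.
- by have [?|?] := leP lo hi; lra.
Qed.

End clamp.

(** * Backward trajectories with controlled running cost *)

Section trajectory.
Context {R : realType} {N : nat}.

(** Reversing time gives the derivative of [y] in direction [-1], and the differential is linear. *)
Lemma derive_reverse (y : R -> 'rV[R]_N) (t0 t : R) (w : 'rV[R]_N) :
  is_derive (t0 - t) 1 y w -> 'D_1 (fun s => y (t0 - s)) t = - w.
Proof.
move=> [dy <-].
have dy' : differentiable y (t0 - t) by exact/derivable1_diffP.
rewrite [in RHS]deriveE// -linearN -deriveE// /derive.
set q := (X in lim (X @ _)); set q' := (X in _ = lim (X @ _)).
suff -> : q = q' by [].
apply/funext => h; rewrite /q /q' /=; congr (_ *: (y _ - _)).
by rewrite [h *: 1]mulr1 [h *: -1]mulrN1; ring.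
Qed.

Variables (T : R) (L : R -> 'rV[R]_N -> 'rV[R]_N -> \bar R).
Hypothesis L1 : lsc_L T L.
Hypothesis L2 : forall t x, 0 <= t <= T -> econvex (L t x) /\ eproper (L t x).
Hypothesis L3 : forall t x v (tn : nat -> R) (xn : nat -> 'rV[R]_N),
  0 <= t <= T -> (forall n, 0 <= tn n <= T) ->
  tn @ \oo --> t -> xn @ \oo --> x ->
  exists vn : nat -> 'rV[R]_N, vn @ \oo --> v /\
    (fun n => L (tn n) (xn n) (vn n)) @ \oo --> L t x v.

(** The local selection is made global by clamping, Peano's theorem runs in reversed time, and the
    cost bound is claimed only while the clamps are inactive. *)
Lemma backward_trajectory (t0 c e : R) (x0 v0 : 'rV[R]_N) : 0 < t0 <= T ->
  (L t0 x0 v0 < c%:E)%E -> 0 < e ->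
  exists2 h : R, 0 < h <= t0 & exists z : R -> 'rV[R]_N,
  [/\ z t0 = x0, forall t1, abs_cont_on t1 t0 z,
      forall t : R, t0 - h <= t < t0 -> (L t (z t) ('D_1 z t) <= c%:E)%E &
      forall t : R, t <= t0 -> `|x0 - z t - (t0 - t) *: v0| <= e * (t0 - t)].
Proof.
move=> /andP[t00 t0T] Lc e0.
have t0T' : 0 <= t0 <= T by rewrite ltW.
have [d d0 [f fP]] := continuous_selection L1 L2 L3 t0T' Lc e0.
(* The first bound keeps the clamped box inside the domain of the selection, the second keeps
   clamped times nonnegative. *)
pose a := Num.min (d / 2) t0.
have a0 : 0 < a by rewrite lt_min t00 divr_gt0.
have ad : a < d by rewrite gt_min; apply/orP; left; lra.
have at0 : a <= t0 by rewrite ge_min lexx orbT.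
pose ct (t : R) := clamp (t0 - a) t0 t.
pose cx (z : 'rV[R]_N) : 'rV[R]_N :=
  \row_i clamp (x0 ord0 i - a) (x0 ord0 i + a) (z ord0 i).
have ctP t : t0 - a <= ct t <= t0 by apply: clamp_itv; lra.
have ctT t : 0 <= ct t <= T.
  by have /andP[? ?] := ctP t; apply/andP; split; lra.
have ctd t : `|ct t - t0| < d.
  by have /andP[? ?] := ctP t; rewrite ltr_norml; apply/andP; split; lra.
have cxd z : `|cx z - x0| < d.
  apply: (le_lt_trans _ ad); rewrite normrv_le ?ltW//; apply/forallP => i.
  have : x0 ord0 i - a <= clamp (x0 ord0 i - a) (x0 ord0 i + a) (z ord0 i) <= x0 ord0 i + a.
    by apply: clamp_itv; lra.
  by rewrite !mxE => /andP[? ?]; rewrite ler_norml; apply/andP; split; lra.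
have cx_dist z z' : `|cx z - cx z'| <= `|z - z'|.
  rewrite normrv_le//; apply/forallP => i; rewrite !mxE.
  apply: (le_trans (clamp_dist _ _ _)); first by lra.
  by have := lexx `|z - z'|; rewrite normrv_le// => /forallP/(_ i); rewrite !mxE.
(* In the reversed time [s = t0 - t] velocities change sign. *)
pose G (s : R) (z : 'rV[R]_N) := - f (ct (t0 - s)) (cx z).
have Gv0 s z : `|G s z - - v0| <= e.
  by rewrite -normrN opprB opprK addrC; have [] := fP _ _ (ctT (t0 - s)) (ctd _) (cxd z).
have GM s z : `|G s z| <= `|v0| + e.
  rewrite -[G s z](subrK (- v0)) addrC; apply: (le_trans (ler_normD _ _)).
  by rewrite normrN lerD2l.
have Gc (t : R) (z : 'rV[R]_N) (b : R) : 0 < b -> exists2 r : R, 0 < r &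
    forall s z', `|s - t| < r -> `|z' - z| < r -> `|G s z' - G t z| <= b.
  move=> b0; have [_ _ /(_ b b0)[r r0 rP]] := fP _ _ (ctT (t0 - t)) (ctd _) (cxd z).
  exists r => // s z' st zz; rewrite /G -opprD normrN.
  apply: rP => //.
    apply: (le_lt_trans (clamp_dist _ _ _)); first by lra.
    by rewrite opprB addrC addrA subrK distrC.
  exact: le_lt_trans (cx_dist _ _) zz.
have [y [y0 dy yw]] := peano x0 GM Gc.
have ylip : forall s t : R, 0 <= s <= t -> `|y t - y s| <= (`|v0| + e) * (t - s).
  move=> s t st; have := yw 0 (`|v0| + e) _ s t st; rewrite scaler0 subr0; apply.
  by move=> ? ?; rewrite subr0.
pose M := `|v0| + e; have M0 : 0 < M by rewrite ltr_wpDl.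
(* The speed is at most [M], so for a duration [h] the arc stays within [a] of [x0], where the
   clamps are the identity. *)
pose h := Num.min a (a / M).
have h0 : 0 < h by rewrite lt_min a0 divr_gt0.
have ha : h <= a by rewrite ge_min lexx.
have hM : M * h <= a by rewrite mulrC -ler_pdivlMr// ge_min lexx orbT.
exists h; first by rewrite h0 (le_trans ha).
exists (fun t => y (t0 - t)); split.
- by rewrite subrr.
- move=> t1; apply: (@abs_cont_on_lipschitz _ _ _ _ M); first exact: ltW.
  move=> s t _ st tt0; rewrite distrC.
  have -> : t - s = (t0 - s) - (t0 - t) by ring.
  by apply: ylip; apply/andP; split; lra.
- move=> t /andP[ht tt0]; have tt0' : 0 < t0 - t by rewrite subr_gt0.
  have yx : `|y (t0 - t) - x0| <= M * (t0 - t).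
    by rewrite -y0 -{2}[t0 - t]subr0; apply: ylip; rewrite lexx ltW.
  rewrite (derive_reverse (dy _ tt0')) opprK.
  have -> : ct (t0 - (t0 - t)) = t.
    by rewrite opprB addrC subrK; apply: clamp_id; apply/andP; split; lra.
  have -> : cx (y (t0 - t)) = y (t0 - t).
    apply/rowP => i; rewrite mxE clamp_id//.
    move: yx; have : M * (t0 - t) <= a.
      by apply: le_trans hM; apply: ler_wpM2l; [exact: ltW|lra].
    move=> Mt /le_trans/(_ Mt); rewrite (normrv_le _ (ltW a0)) => /forallP/(_ i).
    by rewrite !mxE ler_norml => /andP[? ?]; apply/andP; split; lra.
  have [] // := fP t (y (t0 - t)).
  + by apply/andP; split; lra.
  + by rewrite ltr_norml; apply/andP; split; lra.
  apply: (le_lt_trans yx); apply: (le_lt_trans _ ad); apply: le_trans hM.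
  by apply: ler_wpM2l; [exact: ltW|lra].
(* The clamped field is everywhere within [e] of [- v0], so this holds for all earlier times. *)
- move=> t tt0; have := yw (- v0) e Gv0 0 (t0 - t).
  rewrite lexx subr_ge0 tt0 subr0 y0 => /(_ isT).
  by rewrite scalerN opprK -normrN opprD opprB.
Qed.

End trajectory.

Theorem theorem5p5 (R : realType) (N : nat) (T : R)
  (L : R -> 'rV[R]_N -> 'rV[R]_N -> \bar R) (g : 'rV[R]_N -> \bar R) :
  0 < T ->
  (* (L1) *) lsc_L T L ->
  (* (L2) *) (forall t x, 0 <= t <= T -> econvex (L t x) /\ eproper (L t x)) ->
  (* (L3) *) (forall t x v (tn : nat -> R) (xn : nat -> 'rV[R]_N),
                0 <= t <= T -> (forall n, 0 <= tn n <= T) ->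
                tn @ \oo --> t -> xn @ \oo --> x ->
                exists vn : nat -> 'rV[R]_N, vn @ \oo --> v /\
                  (fun n => L (tn n) (xn n) (vn n)) @ \oo --> L t x v) ->
  (* (L4) *) (forall r : R, 0 <= r -> exists2 C : R, 0 <= C &
                forall t x v, 0 <= t <= T -> enorm x <= r -> C < enorm v ->
                  L t x v = +oo%E) ->
  (* (L5) *) (exists c : R -> R, exists Nul : set R,
                [/\ (forall t, 0 <= t <= T -> 0 <= c t),
                    (@lebesgue_measure R).-integrable [set t | 0 <= t <= T]
                       (fun t => (c t)%:E),
                    (@lebesgue_measure R).-negligible Nul &
                    forall t x v, 0 <= t <= T -> ~ Nul t ->
                      c t * (1 + enorm x) < enorm v -> L t x v = +oo%E]) ->
  eproper g -> lower_semicontinuous g ->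
  forall (t0 : R) (x0 : 'rV[R]_N),
    value_fun T L g t0 x0 \is a fin_num -> 0 < t0 <= T ->
    forall v0 : 'rV[R]_N, L t0 x0 v0 \is a fin_num ->
      (subderiv (value_fun T L g) t0 x0 (-1) (- v0) <= L t0 x0 v0)%E.
Proof.
move=> T0 L1 L2 L3 _ _ _ _ t0 x0 Vfin t0T v0 Lfin.
have /andP[t00 t0T'] := t0T.
(* With slack [e], it suffices to find for each [eps] one difference quotient at most
   [L t0 x0 v0 + e]. *)
apply/lee_addgt0Pr => e e0; apply: ge_ereal_sup => _ [eps /= eps0 <-].
pose c := fine (L t0 x0 v0) + e.
have cE : (L t0 x0 v0 + e%:E = c%:E)%E by rewrite -(fineK Lfin).
have Lc : (L t0 x0 v0 < c%:E)%E by rewrite -cE lteDl.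
rewrite cE.
(* A sup-norm error of [eps / K] has Euclidean size strictly below [eps]. *)
pose K : R := Num.sqrt N%:R + 1.
have K0 : 0 < K by rewrite ltr_wpDl// sqrtr_ge0.
have [h /andP[h0 ht0] [z [zt0 zac zL zv]]] :=
  backward_trajectory L1 L2 L3 t0T Lc (divr_gt0 eps0 K0).
pose tau := Num.min h (eps / 2).
have tau0 : 0 < tau by rewrite lt_min h0 divr_gt0.
have tauh : tau <= h by rewrite ge_min lexx.
have taueps : tau < eps by rewrite gt_min; apply/orP; right; lra.
have tauE : t0 - (t0 - tau) = tau by ring.
have Vle : (value_fun T L g (t0 - tau)%R (z (t0 - tau)%R) <=
    value_fun T L g t0 x0 + (c * tau)%:E)%E.
  rewrite -[X in (c * X)%:E]tauE.
  apply: value_fun_backward => //; [lra|lra|].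
  by move=> t /andP[? ?]; apply: zL; apply/andP; split; lra.
(* Chosen so that the step [tau] in direction [(-1, Y)] lands exactly on the arc. *)
pose Y := tau^-1 *: (z (t0 - tau) - x0).
have xY : x0 + tau *: Y = z (t0 - tau).
  by rewrite scalerA mulfV ?gt_eqF// scale1r addrC subrK.
apply: ereal_inf_le; exists ((value_fun T L g (t0 + tau * -1)%R (x0 + tau *: Y)%R -
    value_fun T L g t0 x0) * (tau^-1)%:E)%E.
  exists tau, (-1), Y; split => //.
  - by rewrite tau0.
  - by rewrite subrr normr0.
  apply: (le_lt_trans (enorm_le_norm _)).
  have Yv : `|Y - - v0| <= eps / K.
    have -> : Y - - v0 = - (tau^-1 *: (x0 - z (t0 - tau) - (t0 - (t0 - tau)) *: v0)).
      apply/rowP => i; rewrite !mxE; field; by rewrite gt_eqF.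
    rewrite normrN normrZ gtr0_norm ?invr_gt0// ler_pdivrMl//.
    have := zv (t0 - tau); rewrite tauE.
    by rewrite mulrC; apply; lra.
  apply: (le_lt_trans (ler_wpM2l (sqrtr_ge0 _) Yv)).
  by rewrite mulrCA gtr_pMr// ltr_pdivrMr// mul1r ltrDl.
by rewrite xY mulrN1 lee_pdivrMr// leeBlDl.
Qed.
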